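(* Let $s\ge 1$ be an integer, let $c_1,\dots,c_s$ be the zeros of the $s$th shifted Legendre polynomial $\frac{d^s}{dx^s}\big(x^s(x-1)^s\big)$, and let $\tau>0$ be the time step. Suppose that $({\bm U}^n,{\bm Q}^n)_{n=0}^{M}$ in $\mathbb{V}_h\times\mathbb{V}_h$ is produced by the $s$-stage Gauss collocation scheme: for each $n=0,1,\dots,M-1$ there are $N$-dimensional real vector polynomials ${\bm u}(t),{\bm v}(t)$ of degree (at most) $s$ such that ${\bm u}(t_n)={\bm U}^n$, ${\bm v}(t_n)={\bm Q}^n$, and for $i=1,\dots,s$, with $t_n^i=t_n+c_i\tau$, $$\dot{\bm u}(t_n^i)={\bm D}\Big({\bm v}(t_n^i)-{\bm u}(t_n^i)^2+{\bm D}_1\big(({\bm D}_1{\bm u}(t_n^i))\cdot{\bm u}(t_n^i)\big)\Big),$$ $$\dot{\bm v}(t_n^i)=-{\bm u}(t_n^i)\cdot\dot{\bm u}(t_n^i)-\big({\bm D}_1{\bm u}(t_n^i)\big)\cdot\big({\bm D}_1\dot{\bm u}(t_n^i)\big),$$ and ${\bm U}^{n+1}={\bm u}(t_n+\tau)$, ${\bm Q}^{n+1}={\bm v}(t_n+\tau)$. Then the scheme is energy-preserving: with $E^n=\langle{\bm U}^n,{\bm Q}^n\rangle_h$, $$E^{n+1}=E^n,\qquad n=0,1,\dots,M-1 .$$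
   Context: $\Omega=[a,a+L]$, $N$ is an even positive integer, $h=L/N$, $x_j=a+jh$, $\mu=2\pi/L$. $\mathbb{V}_h$ is the space of real vectors ${\bm U}=(U_0,\dots,U_{N-1})^T$, identified with $N$-periodic mesh functions ($U_{j+N}=U_j$), with inner product $\langle{\bm U},{\bm V}\rangle_h=h\sum_{j=0}^{N-1}U_jV_j$. The symbol $\cdot$ denotes the componentwise product of vectors, and ${\bm U}^2={\bm U}\cdot{\bm U}$. A dot over a function denotes $d/dt$; $t_n=n\tau$, and $M$ is the number of time steps. Fourier pseudo-spectral differentiation matrices: let $g_j(x)=\frac1N\sum_{l=-N/2}^{N/2}\frac1{a_l}e^{\mathrm{i}l\mu(x-x_j)}$, with $a_l=1$ for $|l|<N/2$ and $a_l=2$ for $|l|=N/2$. For $r=1,2$, ${\bm D}_r$ is the $N\times N$ matrix with entries $({\bm D}_r)_{j,k}=\frac{d^rg_k}{dx^r}(x_j)$, $j,k=0,\dots,N-1$. ${\bm D}_1$ is real skew-symmetric and ${\bm D}_2$ is real symmetric; with the discrete Fourier transform matrix $({\bm F}_N)_{j,k}=\frac1{\sqrt N}e^{-\mathrm{i}jk2\pi/N}$ and its conjugate transpose ${\bm F}_N^H$ one has ${\bm D}_1={\bm F}_N^H\Lambda_1{\bm F}_N$, $\Lambda_1=\mathrm{i}\mu\,\mathrm{diag}(0,1,\dots,\frac N2-1,0,-\frac N2+1,\dots,-1)$, and ${\bm D}_2={\bm F}_N^H\Lambda_2{\bm F}_N$, $\Lambda_2=[\mathrm{i}\mu\,\mathrm{diag}(0,1,\dots,\frac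 N2-1,\frac N2,-\frac N2+1,\dots,-1)]^2$. ${\bm D}=({\bm I}-{\bm D}_2)^{-1}{\bm D}_1$, where ${\bm I}$ is the $N\times N$ identity matrix. *)

(* Defs.v *)
From HB Require Import structures.
From mathcomp Require Import all_boot all_order all_algebra.
From mathcomp Require Import complex.
From mathcomp Require Import all_classical all_reals all_analysis.

Set Implicit Arguments.
Unset Strict Implicit.
Unset Printing Implicit Defensive.

Import Order.TTheory GRing.Theory Num.Theory.

Local Open Scope ring_scope.
Local Open Scope complex_scope.

Section FourierPseudoSpectral.

Variable R : realType.

Definition expi (x : R) : R[i] := cos x +i* sin x.

(* The r-th derivative of a complex-valued function of a real variable is
   taken componentwise: the libraries put no real normed-module topology on
   [R[i]], as [derive1n] would require. *)
Definition cderive1n (r : nat) (f : R -> R[i]) (x : R) : R[i] :=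
  derive1n r (fun y => complex.Re (f y)) x +i*
  derive1n r (fun y => complex.Im (f y)) x.

Section Mesh.

Variables (a L : R) (N : nat).

Definition mesh_size : R := L / N%:R.

Definition mesh_point (j : nat) : R := a + j%:R * mesh_size.

Definition wavenumber : R := 2 * pi / L.

Definition trig_coef (l : int) : R[i] :=
  if (`|l| < N./2)%N then 1 else 2.

(* l = m - N/2 runs over -N/2, ..., N/2 as m runs over 0, ..., N. *)
Definition trig_basis (j : nat) (x : R) : R[i] :=
  N%:R^-1 * \sum_(m < N.+1)
    let l : int := m%:Z - (N./2)%:Z in
    (trig_coef l)^-1 * expi (l%:~R * wavenumber * (x - mesh_point j)).

Definition diff_mxC (r : nat) : 'M[R[i]]_N :=
  \matrix_(j, k) cderive1n r (trig_basis k) (mesh_point j).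

(* No information is lost by [Re]: see [diff_mxC_real]. *)
Definition diff_mx (r : nat) : 'M[R]_N := map_mx (@complex.Re R) (diff_mxC r).

Definition diff_op : 'M[R]_N := invmx (1%:M - diff_mx 2) *m diff_mx 1.

Definition inner_h (U V : 'cV[R]_N) : R := mesh_size * \sum_j U j 0 * V j 0.

End Mesh.

Lemma trig_basis_real (a L : R) (N : nat) (j : nat) (x : R) :
  ~~ odd N -> complex.Im (trig_basis a L N j x) = 0.
Proof.
move=> Ne; set z := trig_basis _ _ _ _ _.
suff : conjc z = z.
  case: z => u v /= [] /eqP; rewrite eq_sym -subr_eq0 opprK -mulr2n.
  by rewrite mulrn_eq0 => /eqP.
rewrite /z /trig_basis rmorphM fmorphV rmorph_nat rmorph_sum; congr (_ * _).
rewrite (reindex_inj rev_ord_inj); apply: eq_bigr => m _ /=.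
have -> : (N.+1 - m.+1)%N%:Z - (N./2)%:Z = - (m%:Z - (N./2)%:Z).
  have mN : (m <= N)%N by rewrite -ltnS.
  rewrite subSS -subzn // opprB addrAC; congr (_ - _).
  rewrite -{1}(odd_double_half N) (negbTE Ne) add0n -addnn PoszD.
  by rewrite addrK.
rewrite rmorphM fmorphV; congr (_^-1 * _).
  by rewrite /trig_coef abszN; case: ifP => _; rewrite ?rmorph1 ?rmorph_nat.
by rewrite rmorphN /= !mulNr /expi /= cosN sinN opprK.
Qed.

Lemma diff_mxC_real (a L : R) (N r : nat) :
  ~~ odd N -> diff_mxC a L N r = map_mx (real_complex R) (diff_mx a L N r).
Proof.
move=> Ne; apply/matrixP => j k; rewrite !mxE /cderive1n /=.
congr (_ +i* _).
under eq_fun do rewrite trig_basis_real //.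
elim: r (mesh_point a L N j) => [//|r IH] x.
rewrite derive1nS (_ : derive1n r _ = cst 0) ?derive1_cst //.
by apply/funext => y; rewrite IH.
Qed.

End FourierPseudoSpectral.

Section Collocation.

Variable R : realType.

Definition shifted_legendre (s : nat) : {poly R} :=
  ('X ^+ s * ('X - 1) ^+ s)^`(s).

Definition cwise_mul (N : nat) (U V : 'cV[R]_N) : 'cV[R]_N :=
  map2_mx *%R U V.

Definition vpoly_eval (N : nat) (p : 'cV[{poly R}]_N) (t : R) : 'cV[R]_N :=
  map_mx (fun q => q.[t]) p.

Definition vpoly_deriv (N : nat) (p : 'cV[{poly R}]_N) : 'cV[{poly R}]_N :=
  map_mx (fun q => q^`()) p.

Definition vpoly_deg_le (N s : nat) (p : 'cV[{poly R}]_N) : Prop :=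
  forall j, (size (p j 0%R) <= s.+1)%N.

Local Notation "U .* V" := (cwise_mul U V) (at level 40, left associativity).

Definition collocation_eqns (a L : R) (N : nat) (u v : 'cV[{poly R}]_N)
    (t : R) : Prop :=
  let D := diff_op a L N in
  let D1 := diff_mx a L N 1 in
  let ut := vpoly_eval u t in
  let vt := vpoly_eval v t in
  let dut := vpoly_eval (vpoly_deriv u) t in
  let dvt := vpoly_eval (vpoly_deriv v) t in
  dut = D *m (vt - ut .* ut + D1 *m ((D1 *m ut) .* ut)) /\
  dvt = - (ut .* dut) - (D1 *m ut) .* (D1 *m dut).

Definition gauss_collocation_step (a L : R) (N s : nat) (c : 'I_s -> R)
    (tau t : R) (U Q U' Q' : 'cV[R]_N) : Prop :=
  exists u v : 'cV[{poly R}]_N,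
    [/\ vpoly_deg_le s u /\ vpoly_deg_le s v,
        vpoly_eval u t = U /\ vpoly_eval v t = Q,
        forall i : 'I_s, collocation_eqns a L u v (t + c i * tau)
      & U' = vpoly_eval u (t + tau) /\ Q' = vpoly_eval v (t + tau)].

End Collocation.

(* Main.v *)
Require Import Defs.
From HB Require Import structures.
From mathcomp Require Import all_boot all_order all_algebra.
From mathcomp Require Import complex polyrcf polyorder cauchyreals.
From mathcomp Require Import ring zify.
From mathcomp Require Import all_classical all_reals all_analysis.

Set Implicit Arguments.
Unset Strict Implicit.
Unset Printing Implicit Defensive.

Import Order.TTheory GRing.Theory Num.Theory.

Local Open Scope ring_scope.

(* At a collocation node, [d/dt <u, v> = <u', w>] with [u' = D w], and this
   vanishes because [D] is skew: [D_1] is skew, [D_2] is symmetric, and they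
   commute, both being circulant.  So the derivative of the polynomial
   [<u, v>], which has degree at most [2s - 1], vanishes at the [s] distinct
   roots of the shifted Legendre polynomial; it is the product of that
   polynomial and a cofactor of degree below [s], and such products integrate
   to zero. *)

(** * Polynomial calculus: multiplicity, integration by parts, Rolle *)

Lemma deriv_eq0_horner (R : realDomainType) (p : {poly R}) (x y : R) :
  p^`() = 0 -> p.[x] = p.[y].
Proof.
move=> p'0; have: (size p <= 1)%N.
  by have := size_deriv p; rewrite p'0 size_poly0; case: (size p) => [|[]].
by move=> /size1_polyC ->; rewrite !hornerC.
Qed.

(** Each differentiation costs at most one factor ['X - a]. *)
Lemma root_derivn_mul_XsubC (R : comNzRingType) (a : R) (n k : nat)
    (q : {poly R}) :
  (k < n)%N -> root ((('X - a%:P) ^+ n * q)^`(k)) a.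
Proof.
move=> kn; suff [q' ->] : exists q',
    (('X - a%:P) ^+ n * q)^`(k) = ('X - a%:P) ^+ (n - k) * q'.
  rewrite /root hornerM horner_exp hornerXsubC subrr expr0n.
  by rewrite subn_eq0 leqNgt kn /= mul0r.
elim: k kn => [|k IH] kn; first by exists q; rewrite subn0.
have [q' E] := IH (ltnW kn).
exists (q' *+ (n - k) + ('X - a%:P) * q'^`()).
rewrite derivnS E derivM deriv_exp derivXsubC mul1r -subnS.
have nk : (n - k = (n - k.+1).+1)%N by rewrite subnSK // ltnW.
by rewrite nk exprSr /=; ring.
Qed.

(* Repeated integration by parts, phrased with a primitive [F]. *)
Lemma derivn_orthogonal (R : realDomainType) (x y : R) (p : {poly R})
    (s : nat) :
  (forall k, (k < s)%N -> root p^`(k) x /\ root p^`(k) y) ->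
  forall r F : {poly R}, (size r <= s)%N -> F^`() = p^`(s) * r ->
  F.[x] = F.[y].
Proof.
elim: s => [|s IH] hp r F.
  rewrite leqn0 size_poly_eq0 => /eqP -> F'; apply: deriv_eq0_horner.
  by rewrite F' mulr0.
move=> sr F'; have [/rootP px /rootP py] := hp s (ltnSn s).
(* The new [F] is a primitive of minus the [s]-th derivative of [p] times the derivative of [r]; the
   subtracted boundary term vanishes at [x] and [y]. *)
have := IH (fun k ks => hp k (ltnW ks)) (- r^`()) (F - p^`(s) * r).
rewrite !hornerD !hornerN !hornerM px py !mul0r !subr0; apply.
  by rewrite size_polyN size_deriv -ltnS; case: (size r) sr.
by rewrite derivB derivM F' derivnS; ring.
Qed.

(** Rolle's theorem in each gap. The endpoints are kept apart from the list, so the step can be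
    iterated on the same interval. *)
Lemma rolle_seq (R : rcfType) (p : {poly R}) (rs : seq R) (x y : R) :
  path <%R x (rcons rs y) -> all (root p) (x :: rcons rs y) ->
  exists rs', [/\ size rs' = (size rs).+1, path <%R x (rcons rs' y) &
                  all (root p^`()) rs'].
Proof.
elim: rs x => [|z rs IH] x /=.
  rewrite !andbT => xy /andP[/rootP px /rootP py].
  have [c] := poly_rolle xy (etrans px (esym py)).
  rewrite in_itv /= => /andP[xc cy] pc; exists [:: c].
  by rewrite /= xc cy rootE pc eqxx.
case/andP=> xz pz /and3P[/rootP px rz ap].
have [] := IH z pz; first by rewrite /= rz.
move=> rs' [srs' prs' ars'].
have [c] := poly_rolle xz (etrans px (esym (rootP rz))).
rewrite in_itv /= => /andP[xc cz] pc; exists (c :: rs').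
by rewrite /= srs' xc (path_le lt_trans cz) // rootE pc eqxx.
Qed.

(** * Shifted Legendre polynomials and Gauss quadrature *)

Section ShiftedLegendre.
Variables (R : realType) (s : nat).

Let base : {poly R} := 'X ^+ s * ('X - 1) ^+ s.

Lemma legendre_baseE : base = ('X - 0%:P) ^+ s * ('X - 1%:P) ^+ s.
Proof. by rewrite /base subr0. Qed.

Lemma legendre_base_ends (k : nat) :
  (k < s)%N -> root base^`(k) 0 /\ root base^`(k) 1.
Proof.
move=> ks; rewrite legendre_baseE; split; first exact: root_derivn_mul_XsubC.
by rewrite mulrC; apply: root_derivn_mul_XsubC.
Qed.

Lemma size_shifted_legendre : size (shifted_legendre R s) = s.+1.
Proof.
rewrite size_derivn -/base legendre_baseE.
rewrite size_monicM ?monic_exp ?monicXsubC //.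
  by rewrite !size_exp_XsubC; lia.
by rewrite expf_neq0 // polyXsubC_eq0.
Qed.

(** For [k < s], the [k]-th derivative of [base] still vanishes at 0 and 1; with its [k] roots in
    between, Rolle gives [k + 1] interior roots of the next derivative. *)
Lemma shifted_legendre_roots : exists rs : seq R,
  [/\ size rs = s, uniq rs & all (root (shifted_legendre R s)) rs].
Proof.
suff [rs [srs prs ars]] : exists rs : seq R, [/\ size rs = s,
    path <%R 0 (rcons rs 1) & all (root base^`(s)) rs].
  exists rs; split=> //; have /lt_sorted_uniq := path_sorted prs.
  by rewrite rcons_uniq => /andP[].
(* Induction on the order of the derivative, with the exponent [s] inside [base] and the upper bound
   kept fixed. *)
have: (s <= s)%N by []; elim: {1 3 4}s => [|k IH] ks.
  by exists [::]; rewrite /= ltr01.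
have [rs [srs prs ars]] := IH (ltnW ks).
have [r0 r1] := legendre_base_ends ks.
have [] := rolle_seq (p := base^`(k)) prs.
  by rewrite /= all_rcons r0 r1 ars.
by rewrite srs -derivnS => rs' ?; exists rs'.
Qed.

(** Having as many distinct roots as its degree, the polynomial is a nonzero scalar times the
    product of the corresponding linear factors. *)
Lemma dvdp_shifted_legendre (q : {poly R}) :
  (forall x, root (shifted_legendre R s) x -> root q x) ->
  shifted_legendre R s %| q.
Proof.
move=> hq; have [rs [srs urs ars]] := shifted_legendre_roots.
have us : poly.uniq_roots rs by rewrite poly.uniq_rootsE.
rewrite (all_roots_prod_XsubC _ ars us) ?size_shifted_legendre ?srs //.
rewrite dvdpZl ?lead_coef_eq0 -?size_poly_eq0 ?size_shifted_legendre //.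
by apply: uniq_roots_dvdp us; apply/allP => x /(allP ars)/hq.
Qed.

(* Exactness of Gauss quadrature on polynomials of degree at most 2s - 1,
   applied to the derivative of [F]. *)
Lemma gauss_nodes_ends (F : {poly R}) (t tau : R) :
  (size F <= s.*2.+1)%N ->
  (forall x, root (shifted_legendre R s) x -> root F^`() (t + x * tau)) ->
  F.[t + tau] = F.[t].
Proof.
(* [l] maps 0 to [t] and 1 to [t + tau], which pulls the problem back to the interval of the
   Legendre polynomial. *)
move=> sF hF; pose l : {poly R} := t%:P + tau *: 'X; pose G := F \Po l.
have G_at x : G.[x] = F.[t + x * tau] by rewrite horner_comp !hornerE mulrC.
have G' : G^`() = tau *: (F^`() \Po l).
  rewrite deriv_comp derivD derivC derivZ derivX add0r alg_polyC mulrC.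
  exact: mul_polyC.
have sG : (size G <= s.*2.+1)%N.
  rewrite (leq_trans (size_comp_poly_leq _ _)) // ltnS.
  have sl : (size l <= 2)%N.
    rewrite (leq_trans (size_polyD _ _)) // geq_max.
    rewrite (leq_trans (size_polyC_leq1 _)) //.
    by rewrite (leq_trans (size_scale_leq _ _)) // size_polyX.
  rewrite (@leq_trans ((size F).-1 * 1)%N) //.
    by rewrite leq_mul2l -[(size l).-1]subn1 leq_subLR sl orbT.
  by rewrite muln1 -subn1 leq_subLR.
have : shifted_legendre R s %| G^`().
  apply: dvdp_shifted_legendre => x /hF /rootP Fx.
  rewrite G' rootE hornerZ horner_comp !hornerE mulrC.
  by rewrite [tau * x]mulrC Fx mul0r.
have -> : t + tau = t + 1 * tau by rewrite mul1r.
have E : F.[t] = G.[0] by rewrite G_at mul0r addr0.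
rewrite -G_at E => /dvdpP[r Gr]; apply/esym.
apply: (derivn_orthogonal legendre_base_ends (r := r)); last by rewrite mulrC.
have [->|r0] := eqVneq r 0; first by rewrite size_poly0.
have l0 : shifted_legendre R s != 0.
  by rewrite -size_poly_eq0 size_shifted_legendre.
(* The derivative of [G] has size at most [2s] and equals [size r + s], whence [size r <= s]. *)
have := size_deriv G; rewrite Gr size_mul // size_shifted_legendre.
by move: sG; move: (size G) (size r) => x y; lia.
Qed.

End ShiftedLegendre.

(** * Derivatives of trigonometric sums *)

Section TrigonometricSums.
Variables (R : realType) (n : nat) (th : 'I_n -> R) (x0 : R).

(** Differentiation exchanges this family with [sin_sum], acting only on the coefficients. *)
Definition cos_sum (b : 'I_n -> R) (x : R) : R :=
  \sum_i b i * cos (th i * (x - x0)).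

Definition sin_sum (b : 'I_n -> R) (x : R) : R :=
  \sum_i b i * sin (th i * (x - x0)).

Lemma derive1_cos_sum b :
  derive1 (cos_sum b) = sin_sum (fun i => - (b i * th i)).
Proof.
apply/funext => x; rewrite derive1E /cos_sum.
have -> : (fun x => \sum_i b i * cos (th i * (x - x0))) =
    \sum_i (fun x => b i * cos (th i * (x - x0))).
  by apply/funext => y; rewrite fct_sumE.
apply: derive_val; apply: is_derive_eq.
apply: eq_bigr => i _ /=; rewrite /GRing.scale /=; ring.
Qed.

Lemma derive1_sin_sum b : derive1 (sin_sum b) = cos_sum (fun i => b i * th i).
Proof.
apply/funext => x; rewrite derive1E /sin_sum.
have -> : (fun x => \sum_i b i * sin (th i * (x - x0))) =
    \sum_i (fun x => b i * sin (th i * (x - x0))).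
  by apply/funext => y; rewrite fct_sumE.
apply: derive_val; apply: is_derive_eq.
apply: eq_bigr => i _ /=; rewrite /GRing.scale /=; ring.
Qed.

End TrigonometricSums.

(** * Periodicity and circulant matrices *)

Lemma periodicz (U V : zmodType) (f : U -> V) (T : U) :
  periodic f T -> forall (z : int) (x : U), f (x + T *~ z) = f x.
Proof.
move=> fT [] m x; first exact: periodicn.
by rewrite NegzE mulrNz -[LHS](periodicn fT m.+1) subrK.
Qed.

Section Circulant.
Variables (R : comNzRingType) (n : nat).
Implicit Types f g : int -> R.

(** The difference is taken in [int]: the matrix is Toeplitz, and circulant once [f] has period
    [n.+1]. *)
Definition circulant_mx f : 'M[R]_n.+1 :=
  \matrix_(j, k) f (j%:Z - k%:Z).

(** On the right [j - k] is taken modulo [n.+1], so it differs from the integer difference by a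
    multiple of the period. *)
Lemma circulant_mxE f (j k : 'I_n.+1) :
  periodic f n.+1%:Z -> circulant_mx f j k = f (j - k)%R.
Proof.
move=> fN; rewrite mxE; set d := (j - k)%R.
have dk : ((d + k)%N %% n.+1)%N = j by have /(congr1 val) := subrK k j.
rewrite -(periodicz fN (- ((d + k)%N %/ n.+1)%N%:Z) d); congr f.
have /(congr1 Posz) := divn_eq (d + k)%N n.+1.
by rewrite dk !PoszD PoszM mulrNz mulrzz; lia.
Qed.

(** Entries of the products are convolutions modulo [n.+1]; replacing the summation index [m] by
    [j + k - m] swaps the two factors. *)
Lemma circulant_mxC f g :
  periodic f n.+1%:Z -> periodic g n.+1%:Z ->
  circulant_mx f *m circulant_mx g = circulant_mx g *m circulant_mx f.
Proof.
move=> fN gN; apply/matrixP => j k; rewrite !mxE.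
rewrite (reindex_inj (inj_comp (addrI (j + k)%R) oppr_inj)) /=.
apply: eq_bigr => m _; rewrite !circulant_mxE // mulrC.
congr (g _ * f _); congr (Posz (nat_of_ord _)).
  by rewrite addrAC addrK.
by rewrite opprB opprD addrCA addNKr.
Qed.

End Circulant.

(* Holds for singular [A] too, where [invmx A = A]. *)
Lemma invmx_commute (R : comUnitRingType) (n : nat) (A B : 'M[R]_n) :
  A *m B = B *m A -> invmx A *m B = B *m invmx A.
Proof.
move=> AB; have [uA|nA] := boolP (A \in unitmx); last by rewrite invmx_out.
by rewrite -[LHS](mulmxK uA) -[_ *m A]mulmxA -AB mulKmx.
Qed.

(** * Entries and symmetries of the differentiation matrices *)

Section DiffMx.
Variables (R : realType) (a L : R) (N : nat).
Hypothesis L_gt0 : 0 < L.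

Let l (m : 'I_N.+1) : int := m%:Z - (N./2)%:Z.
Let freq (m : 'I_N.+1) : R := (l m)%:~R * wavenumber L.
Let coef (m : 'I_N.+1) : R :=
  N%:R^-1 * (if (`|l m| < N./2)%N then 1 else 2)^-1.

(** The coefficients are real, so each exponential contributes just its cosine. *)
Lemma Re_trig_basis (j : nat) :
  (fun x => complex.Re (trig_basis a L N j x)) =
  cos_sum freq (mesh_point a L N j) coef.
Proof.
apply/funext => x; rewrite /trig_basis /cos_sum.
have Re_mul (r : R) (z : R[i]) : complex.Re (r%:C%C * z) = r * complex.Re z.
  by case: z => u v /=; rewrite mul0r subr0.
rewrite -(rmorph_nat (real_complex R)) -fmorphV Re_mul raddf_sum mulr_sumr.
apply: eq_bigr => m _ /=; rewrite /coef -[RHS]mulrA; congr (_ * _).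
have -> : trig_coef R N (m%:Z - (N./2)%:Z) =
    (if (`|l m| < N./2)%N then 1 else 2 : R)%:C%C.
  by rewrite /trig_coef; case: ifP => _; rewrite ?rmorph1 ?rmorph_nat.
by rewrite -fmorphV Re_mul.
Qed.

Lemma mesh_point_sub (j k : nat) :
  mesh_point a L N j - mesh_point a L N k =
  (j%:Z - k%:Z)%:~R * mesh_size L N.
Proof. by rewrite /mesh_point intrB; ring. Qed.

(** [N] mesh steps make up one length [L], over which the phase gains [l m] full turns. *)
Lemma freq_period (m : 'I_N.+1) (z : int) : (0 < N)%N ->
  freq m * ((z + N%:Z)%:~R * mesh_size L N) =
  freq m * (z%:~R * mesh_size L N) + pi *+ 2 *~ l m.
Proof.
move=> N0; have L0 : L != 0 by rewrite gt_eqF.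
have N0' : N%:R != 0 :> R by rewrite pnatr_eq0 -lt0n.
rewrite /freq /wavenumber /mesh_size intrD.
rewrite -[pi *+ 2]mulr_natl -[_ *~ l m]mulrzr.
by field; rewrite N0' L0.
Qed.

(** Derivative of the cosine sum of [Re_trig_basis], [z] mesh steps from its centre; [diff2_symbol]
    is the second derivative there. *)
Definition diff1_symbol (z : int) : R :=
  \sum_m - (coef m * freq m) * sin (freq m * (z%:~R * mesh_size L N)).

Definition diff2_symbol (z : int) : R :=
  \sum_m - (coef m * freq m) * freq m * cos (freq m * (z%:~R * mesh_size L N)).

Lemma diff1_symbol_periodic : (0 < N)%N -> periodic diff1_symbol N%:Z.
Proof.
move=> N0 z; apply: eq_bigr => m _; rewrite freq_period //.
by rewrite (periodicz (@sinD2pi R)).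
Qed.

Lemma diff2_symbol_periodic : (0 < N)%N -> periodic diff2_symbol N%:Z.
Proof.
move=> N0 z; apply: eq_bigr => m _; rewrite freq_period //.
by rewrite (periodicz (@cosD2pi R)).
Qed.

(** Oddness of the sine makes [D_1] skew, as evenness of the cosine makes [D_2] symmetric. *)
Lemma diff1_symbolN (z : int) : diff1_symbol (- z) = - diff1_symbol z.
Proof.
rewrite /diff1_symbol -sumrN; apply: eq_bigr => m _.
by rewrite mulrNz [_ * mesh_size L N]mulNr [freq m * - _]mulrN sinN mulrN.
Qed.

Lemma diff2_symbolN (z : int) : diff2_symbol (- z) = diff2_symbol z.
Proof.
apply: eq_bigr => m _.
by rewrite mulrNz [_ * mesh_size L N]mulNr [freq m * - _]mulrN cosN.
Qed.

Lemma diff_mx1E (j k : 'I_N) : diff_mx a L N 1 j k = diff1_symbol (j%:Z - k%:Z).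
Proof.
rewrite !mxE /cderive1n /= Re_trig_basis derive1_cos_sum.
by apply: eq_bigr => m _; rewrite mesh_point_sub.
Qed.

Lemma diff_mx2E (j k : 'I_N) : diff_mx a L N 2 j k = diff2_symbol (j%:Z - k%:Z).
Proof.
rewrite !mxE /cderive1n /= Re_trig_basis.
rewrite derive1_cos_sum derive1_sin_sum.
by apply: eq_bigr => m _; rewrite mesh_point_sub.
Qed.

Lemma trmx_diff_mx1 : (diff_mx a L N 1)^T = - diff_mx a L N 1.
Proof.
by apply/matrixP => j k; rewrite mxE [RHS]mxE !diff_mx1E -opprB diff1_symbolN.
Qed.

Lemma trmx_diff_mx2 : (diff_mx a L N 2)^T = diff_mx a L N 2.
Proof.
by apply/matrixP => j k; rewrite mxE !diff_mx2E -opprB diff2_symbolN.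
Qed.

End DiffMx.

(** * Skew-symmetry of [D] *)

Lemma diff_mx12_commute (R : realType) (a L : R) (N : nat) : 0 < L ->
  diff_mx a L N 1 *m diff_mx a L N 2 = diff_mx a L N 2 *m diff_mx a L N 1.
Proof.
(* Circulant matrices here have size [n.+1]; for [N = 0] both products are empty. *)
move=> L0; case: N => [|n]; first by rewrite [LHS]flatmx0 [RHS]flatmx0.
have -> : diff_mx a L n.+1 1 = circulant_mx n (diff1_symbol L n.+1).
  by apply/matrixP => j k; rewrite diff_mx1E mxE.
have -> : diff_mx a L n.+1 2 = circulant_mx n (diff2_symbol L n.+1).
  by apply/matrixP => j k; rewrite diff_mx2E mxE.
apply: circulant_mxC.
  exact: diff1_symbol_periodic.
exact: diff2_symbol_periodic.
Qed.

(** Transposition reverses the product, and commutation restores the order. *)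
Lemma trmx_invmx1B_mul (R : comUnitRingType) (n : nat) (A B : 'M[R]_n) :
  A^T = - A -> B^T = B -> A *m B = B *m A ->
  (invmx (1%:M - B) *m A)^T = - (invmx (1%:M - B) *m A).
Proof.
move=> skewA symB AB; rewrite trmx_mul trmx_inv linearB /= trmx1 symB skewA.
rewrite mulNmx invmx_commute // mulmxBl mulmxBr mul1mx mulmx1.
by rewrite AB.
Qed.

Lemma trmx_diff_op (R : realType) (a L : R) (N : nat) : 0 < L ->
  (diff_op a L N)^T = - diff_op a L N.
Proof.
move=> L0; exact: (trmx_invmx1B_mul (trmx_diff_mx1 a L N)
  (trmx_diff_mx2 a L N) (diff_mx12_commute a N L0)).
Qed.

(** * Inner products and the energy balance at a node *)

Section DotProduct.
Variables (R : comNzRingType) (n : nat).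
Implicit Types U V W : 'cV[R]_n.

(** The inner product without its mesh factor, over any commutative ring so as to cover vectors of
    polynomials in time. *)
Definition dot U V : R := \sum_j U j 0 * V j 0.

Lemma dotC U V : dot U V = dot V U.
Proof. by apply: eq_bigr => j _; rewrite mulrC. Qed.

Lemma dotDr U V W : dot U (V + W) = dot U V + dot U W.
Proof. by rewrite -big_split; apply: eq_bigr => j _; rewrite mxE mulrDr. Qed.

Lemma dotNr U V : dot U (- V) = - dot U V.
Proof. by rewrite -sumrN; apply: eq_bigr => j _; rewrite mxE mulrN. Qed.

Lemma dot_mxE U V : dot U V = (U^T *m V) 0 0.
Proof. by rewrite mxE; apply: eq_bigr => j _; rewrite mxE. Qed.

Lemma dot_mulmxr (A : 'M[R]_n) U V : dot U (A *m V) = dot (A^T *m U) V.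
Proof. by rewrite !dot_mxE trmx_mul trmxK mulmxA. Qed.

End DotProduct.

(** Moving [A] across shows that the value is its own opposite. *)
Lemma dot_skew (R : realDomainType) (n : nat) (A : 'M[R]_n) (U : 'cV_n) :
  A^T = - A -> dot U (A *m U) = 0.
Proof.
move=> skewA; have := dot_mulmxr A U U.
rewrite skewA mulNmx [RHS]dotC dotNr => /eqP.
by rewrite -subr_eq0 opprK -mulr2n mulrn_eq0 => /eqP.
Qed.

Lemma dot_cwise_mul (R : realType) (n : nat) (U V W : 'cV[R]_n) :
  dot U (cwise_mul V W) = dot (cwise_mul U V) W.
Proof. by apply: eq_bigr => j _; rewrite !mxE mulrA. Qed.

Lemma cwise_mulC (R : realType) (n : nat) (U V : 'cV[R]_n) :
  cwise_mul U V = cwise_mul V U.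
Proof. by apply/matrixP => i j; rewrite !mxE mulrC. Qed.

(* Moving [D_1] across the inner product turns the left-hand side into
   [<u', w>], where [u' = D w] and [D] is skew. *)
Lemma collocation_energy (R : realType) (a L : R) (N : nat)
    (u v : 'cV[{poly R}]_N) (t : R) : 0 < L ->
  collocation_eqns a L u v t ->
  dot (vpoly_eval (vpoly_deriv u) t) (vpoly_eval v t) +
  dot (vpoly_eval u t) (vpoly_eval (vpoly_deriv v) t) = 0.
Proof.
move=> L0 []; set D := diff_op a L N; set D1 := diff_mx a L N 1.
move: (vpoly_eval u t) (vpoly_eval v t) (vpoly_eval (vpoly_deriv u) t)
  (vpoly_eval (vpoly_deriv v) t) => U V dU dV.
set W := (X in _ = D *m X -> _) => dUE ->.
suff -> : dot dU V + dot U (- cwise_mul U dU - cwise_mul (D1 *m U) (D1 *m dU))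
    = dot W dU by rewrite dUE dot_skew // trmx_diff_op.
rewrite [RHS]dotC /W !dotDr !dotNr -addrA; congr (_ + (_ + _)).
  by rewrite dot_cwise_mul dotC.
(* [D_1] moves from the nonlinear product onto [dU], its skewness supplying the sign. *)
rewrite dot_cwise_mul cwise_mulC.
by rewrite [RHS]dot_mulmxr trmx_diff_mx1 mulNmx [RHS]dotC dotNr.
Qed.

(** * The energy as a polynomial in time *)

Lemma size_dot (R : realType) (N s : nat) (u v : 'cV[{poly R}]_N) :
  vpoly_deg_le s u -> vpoly_deg_le s v -> (size (dot u v) <= s.*2.+1)%N.
Proof.
move=> su sv; apply: leq_trans (size_sum _ _ _) _; apply/bigmax_leqP => j _.
rewrite (leq_trans (size_mul_leq _ _)) //.
move: (su j) (sv j); move: (size (u j 0)) (size (v j 0)) => x y.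
lia.
Qed.

Lemma horner_dot (R : realType) (N : nat) (u v : 'cV[{poly R}]_N) (t : R) :
  (dot u v).[t] = dot (vpoly_eval u t) (vpoly_eval v t).
Proof. by rewrite horner_sum; apply: eq_bigr => j _; rewrite hornerM !mxE. Qed.

Lemma deriv_dot (R : realType) (N : nat) (u v : 'cV[{poly R}]_N) :
  (dot u v)^`() = dot (vpoly_deriv u) v + dot u (vpoly_deriv v).
Proof.
by rewrite raddf_sum -big_split; apply: eq_bigr => j _; rewrite /= derivM !mxE.
Qed.

Lemma inner_hE (R : realType) (L : R) (N : nat) (U V : 'cV[R]_N) :
  inner_h L U V = mesh_size L N * dot U V.
Proof. by []. Qed.

Theorem theorem4p1 (R : realType) (a L : R) (N : nat) (s : nat)
    (c : 'I_s -> R) (tau : R) (M : nat) (U Q : nat -> 'cV[R]_N)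
    (hL : 0 < L) (hN : (0 < N)%N) (hNeven : ~~ odd N) (hs : (1 <= s)%N)
    (hc : forall x : R, root (shifted_legendre R s) x <-> exists i, c i = x)
    (htau : 0 < tau)
    (hscheme : forall n : nat, (n < M)%N ->
       gauss_collocation_step a L c tau (n%:R * tau)
         (U n) (Q n) (U n.+1) (Q n.+1)) :
  forall n : nat, (n < M)%N ->
    inner_h L (U n.+1) (Q n.+1) = inner_h L (U n) (Q n).
Proof.
move=> n nM; have [u [v [[su sv] [<- <-] coll [-> ->]]]] := hscheme n nM.
(* Both energies are values of the single polynomial [dot u v], at [t_n + tau] and [t_n]. *)
rewrite !inner_hE -!horner_dot; congr (_ * _).
apply: (gauss_nodes_ends (size_dot su sv)) => x /hc[i <-].
by rewrite rootE deriv_dot hornerD !horner_dot (collocation_energy hL (coll i)).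
Qed.
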